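(* Let $(u_n)_{n\in\mathbb{N}}$ be a sequence in $\mathbb{T}$. If for every $h\in\mathbb{N}$ the sequence $n\mapsto u_{n+h}-u_n$ is uniformly distributed in $\mathbb{T}$, then for any Besicovitch sequence $(n_k)_{k\in\mathbb{N}}$ the sequence $(u_{n_k})_{k\in\mathbb{N}}$ is uniformly distributed in $\mathbb{T}$. Moreover, if for every $h\in\mathbb{N}$ the sequence $(u_{n+h}-u_n)_{n\in\mathbb{N}}$ is well distributed and $(n_k)_{k\in\mathbb{N}}$ is a uniform Besicovitch sequence, then $(u_{n_k})_{k\in\mathbb{N}}$ is well distributed.
   Context: $\mathbb{N}=\{1,2,\dots\}$; $\mathbb{T}=\mathbb{R}/\mathbb{Z}$ is identified with $[0,1)$. A sequence $(x_n)$ in $\mathbb{T}$ is uniformly distributed if $\lim_{N\to\infty}\frac1N|\{1\le n\le N:x_n\in[a,b)\}|=b-a$ for all $0\le a<b\le1$, and well distributed if $\lim_{N\to\infty}\frac1N|\{M+1\le n\le M+N:x_n\in[a,b)\}|=b-a$ uniformly in $M$, for all $0\le a<b\le1$. For $A\subset\mathbb{N}$, the upper density is $\bar d(A)=\limsup_{N\to\infty}\frac{|A\cap\{1,\dots,N\}|}N$ and the lower Banach density is $d_*(A)=\lim_{N\to\infty}\inf_{M\in\mathbb{N}}\frac{|A\cap\{M+1,\dots,M+N\}|}N$. A function $f:\mathbb{N}\to\mathbb{C}$ is Besicovitch almost periodic if for every $\epsilon>0$ there exist $k\in\mathbb{N}$, $\alpha_1,\dots,\alpha_k\in\mathbb{T}$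 and $c_1,\dots,c_k\in\mathbb{C}$ such that $\limsup_{N\to\infty}\frac1N\sum_{n=1}^N\big|f(n)-\sum_{j=1}^kc_je^{2\pi i\alpha_jn}\big|<\epsilon$. It is uniform Besicovitch almost periodic if for every $\epsilon>0$ there are such $k,\alpha_j,c_j$ with $\limsup_{N\to\infty}\sup_{M\geq 0}\frac1N\sum_{n=M+1}^{M+N}\big|f(n)-\sum_{j=1}^kc_je^{2\pi i\alpha_jn}\big|<\epsilon$. An increasing sequence $(n_k)_{k\in\mathbb{N}}$ in $\mathbb{N}$ is a Besicovitch sequence if the indicator function of $A=\{n_k:k\in\mathbb{N}\}$ is Besicovitch almost periodic and $\bar d(A)>0$; it is a uniform Besicovitch sequence if the indicator function of $A$ is uniform Besicovitch almost periodic and $d_*(A)>0$. *)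

(* Defs.v *)
(* A sequence indexed by {1, 2, ...} is a function on [nat] whose value at 0 is
   never looked at: every window below starts at M + 1. *)
From HB Require Import structures.
From mathcomp Require Import all_boot all_order all_algebra.
From mathcomp Require Import all_classical all_reals all_analysis.
From mathcomp Require Import complex.

Set Implicit Arguments.
Unset Strict Implicit.
Unset Printing Implicit Defensive.

Import Order.TTheory GRing.Theory Num.Theory.
Import numFieldNormedType.Exports.

Local Open Scope classical_set_scope.
Local Open Scope ring_scope.

(* R/Z, each class being represented by its element in [0, 1). *)
Record torus (R : realType) := Torus {
  torus_val :> R ;
  torus_valP : 0 <= torus_val < 1 }.

HB.instance Definition _ (R : realType) := [isSub for @torus_val R].
HB.instance Definition _ (R : realType) := [Choice of torus R by <:].

Section TorusGroup.
Variable R : realType.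
Implicit Types (x y : R) (s t : torus R).

Definition fracr x : R := x - (Num.floor x)%:~R.

Lemma fracr_itv x : 0 <= fracr x < 1.
Proof.
by rewrite /fracr subr_ge0 floor_le ltrBlDl -[1]/(1%:~R) -intrD floorD1_gt.
Qed.

Definition torus_proj x : torus R := Torus (fracr_itv x).

Lemma fracr_id t : fracr t = t.
Proof.
rewrite /fracr (_ : Num.floor _ = 0) ?subr0//.
by apply: floor_def; rewrite add0r; exact: torus_valP.
Qed.

Lemma fracrDz x (m : int) : fracr (x + m%:~R) = fracr x.
Proof. by rewrite /fracr floorDrz// intrKfloor intrD opprD addrACA subrr addr0. Qed.

Lemma fracrDl x y : fracr (fracr x + y) = fracr (x + y).
Proof. by rewrite {2}/fracr addrAC -mulrNz fracrDz. Qed.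

Lemma fracrDr x y : fracr (x + fracr y) = fracr (x + y).
Proof. by rewrite addrC fracrDl addrC. Qed.

Definition torus_zero := torus_proj 0.
Definition torus_opp t := torus_proj (- (t : R)).
Definition torus_add s t := torus_proj ((s : R) + (t : R)).

Lemma torus_addA : associative torus_add.
Proof. by move=> r s t; apply: val_inj; rewrite /= fracrDl fracrDr addrA. Qed.

Lemma torus_addC : commutative torus_add.
Proof. by move=> s t; apply: val_inj; rewrite /= addrC. Qed.

Lemma torus_add0 : left_id torus_zero torus_add.
Proof. by move=> t; apply: val_inj; rewrite /= fracrDl add0r fracr_id. Qed.

Lemma torus_addN : left_inverse torus_zero torus_opp torus_add.
Proof. by move=> t; apply: val_inj; rewrite /= fracrDl addNr. Qed.

HB.instance Definition _ := GRing.isZmodule.Build (torus R)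
  torus_addA torus_addC torus_add0 torus_addN.

End TorusGroup.

Section Notions.
Variable R : realType.
Implicit Types (x : nat -> torus R) (A : set nat) (f : nat -> R[i]).

Definition window_card A (M N : nat) : nat :=
  count (fun n => n \in A) (index_iota M.+1 (M + N).+1).

Definition window_freq A (M N : nat) : R := (window_card A M N)%:R / N%:R.

Definition uniformly_distributed x : Prop :=
  forall a b : R, 0 <= a -> a < b -> b <= 1 ->
    window_freq [set n | a <= (x n : R) < b] 0 N @[N --> \oo] --> b - a.

Definition well_distributed x : Prop :=
  forall a b : R, 0 <= a -> a < b -> b <= 1 ->
    forall eps : R, 0 < eps ->
      \forall N \near \oo, forall M : nat,
        `|window_freq [set n | a <= (x n : R) < b] M N - (b - a)| < eps.

Definition upper_density A : \bar R :=
  limn_esup (fun N => (window_freq A 0 N)%:E).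

Definition lower_banach_density A : \bar R :=
  limn (fun N => ereal_inf
    [set (window_freq A M N)%:E | M in [set M : nat | (0 < M)%N]]).

Definition trig_poly (k : nat) (alpha : 'I_k -> torus R) (c : 'I_k -> R[i])
    (n : nat) : R[i] :=
  \sum_(j < k) c j * Complex (cos (2 * pi * (alpha j : R) * n%:R))
                             (sin (2 * pi * (alpha j : R) * n%:R)).

Definition window_dist f (g : nat -> R[i]) (M N : nat) : R :=
  (\sum_(M.+1 <= n < (M + N).+1) ComplexField.Normc.normc (f n - g n)) / N%:R.

Definition besicovitch_ap f : Prop :=
  forall eps : R, 0 < eps ->
    exists (k : nat) (alpha : 'I_k -> torus R) (c : 'I_k -> R[i]),
      (0 < k)%N /\
      (limn_esup (fun N => (window_dist f (trig_poly alpha c) 0 N)%:E)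
         < eps%:E)%E.

Definition uniform_besicovitch_ap f : Prop :=
  forall eps : R, 0 < eps ->
    exists (k : nat) (alpha : 'I_k -> torus R) (c : 'I_k -> R[i]),
      (0 < k)%N /\
      (limn_esup (fun N => ereal_sup
         [set (window_dist f (trig_poly alpha c) M N)%:E | M in [set: nat]])
         < eps%:E)%E.

Definition increasing_sequence (n_ : nat -> nat) : Prop :=
  (forall k, (0 < k)%N -> (0 < n_ k)%N) /\
  (forall j k, (0 < j)%N -> (j < k)%N -> (n_ j < n_ k)%N).

Definition sequence_range (n_ : nat -> nat) : set nat :=
  [set n_ k | k in [set k | (0 < k)%N]].

Definition besicovitch_sequence (n_ : nat -> nat) : Prop :=
  [/\ increasing_sequence n_,
      besicovitch_ap (\1_(sequence_range n_) : nat -> R[i]) &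
      (0 < upper_density (sequence_range n_))%E].

Definition uniform_besicovitch_sequence (n_ : nat -> nat) : Prop :=
  [/\ increasing_sequence n_,
      uniform_besicovitch_ap (\1_(sequence_range n_) : nat -> R[i]) &
      (0 < lower_banach_density (sequence_range n_))%E].

End Notions.

(* Main.v *)
Require Import Defs.
From mathcomp Require Import all_boot all_order all_algebra.
From mathcomp Require Import all_classical all_reals all_analysis.
From mathcomp Require Import complex ring lra zify.

(** Everything is a statement about averages over the windows (M, M + N] as
    N goes to infinity, uniformly for M in a set S of admissible origins: S = {0}
    gives uniform distribution and upper density, S = N gives well distribution
    and the uniform notions. Both halves of the theorem are the two instances of
    [equidistributed_subsequence].

    Write e(t) for exp (2 pi i t) and fix m > 0. By the easy half of Weyl's criterion
    ([equidistributed_wave]) the hypothesis says that the correlations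
    e(m (u_(n+h) - u_n)) average to 0 for every h > 0. Replacing u_n by
    u_n + omega n multiplies the h-th correlation by a constant of modulus one,
    so van der Corput's difference theorem ([van_der_corput]) applies to all the
    twisted sequences and e(m u_n) e(omega n) averages to 0 for every frequency
    omega. By linearity e(m u_n) p(n) averages to 0 for every trigonometric
    polynomial p, and p may be replaced by the indicator of
    A = {n_k : k >= 1}, a limit of such p in mean ([cvg_mean_approximable]).

    A window of indices k corresponds to a window of integers n between two
    terms of the sequence, and the average of e(m u_(n_k)) over the former is
    the average of 1_A(n) e(m u_n) over the latter divided by the average of 1_A
    ([mean_subsequence]). The divisor stays away from 0. For the lower Banach
    density this is immediate; for the upper density it holds because
    trigonometric polynomials have means, so that the averages of 1_A almost
    converge and a positive limsup forces a positive liminf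
    ([upper_density_gt0]). The hard half of Weyl's criterion
    ([weyl_criterion], by discrete Fejer interpolation) turns the vanishing of
    these averages back into equidistribution.

    Complex exponentials are replaced by cosines with an arbitrary phase: phase
    -pi/2 gives the sine, and the family is stable under products up to linear
    combinations, so all averages are averages of real numbers. *)

Set Implicit Arguments.
Unset Strict Implicit.
Unset Printing Implicit Defensive.

Import Order.TTheory GRing.Theory Num.Theory.
Import numFieldNormedType.Exports.
Local Open Scope classical_set_scope.
Local Open Scope ring_scope.

(** * Trigonometric sums *)

Section Trigonometry.
Variable R : realType.
Implicit Types (x y phi beta : R) (m H q : nat).

Lemma cosM_sum x y : cos x * cos y = (cos (x + y) + cos (x - y)) / 2.
Proof. by rewrite cosD cosB; field. Qed.

Lemma cosM2sin x y : 2 * sin y * cos x = sin (x + y) - sin (x - y).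
Proof. by rewrite sinD sinB; ring. Qed.

(** The Dirichlet kernel: each product sin beta * cos is half a difference of
    sines at consecutive half-integer multiples of 2 beta. *)
Lemma cos_sum_telescope beta phi N :
  2 * sin beta * \sum_(i < N) cos (2 * beta * i%:R + phi) =
  sin (2 * beta * N%:R + phi - beta) - sin (phi - beta).
Proof.
elim: N => [|N IH]; first by rewrite big_ord0 !mulr0 add0r subrr.
rewrite big_ord_recr /= mulrDr IH cosM2sin.
have -> : 2 * beta * N.+1%:R + phi - beta = 2 * beta * N%:R + phi + beta.
  by rewrite -natr1; ring.
by rewrite addrC addrA subrK.
Qed.

(** A sum of cosines in arithmetic progression is bounded independently of its
    length unless the step is a multiple of 2 pi; this controls both the tail of
    the Fejer kernel and the means of trigonometric polynomials. *)
Lemma norm_cos_sum_le beta phi N :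
  `|sin beta| * `|\sum_(i < N) cos (2 * beta * i%:R + phi)| <= 1.
Proof.
have := congr1 Num.norm (cos_sum_telescope beta phi N).
rewrite !normrM (ger0_norm (ler0n _ 2)) => E.
have := ler_normB (sin (2 * beta * N%:R + phi - beta)) (sin (phi - beta)).
rewrite -E => /le_trans/(_ (lerD (sin_max _) (sin_max _))).
by rewrite -mulrA -[_ + _]/(2%:R) -[leRHS]mulr1 ler_pM2l.
Qed.

Lemma sinDn2pi x m : sin (x + 2 * pi * m%:R) = sin x.
Proof.
have -> : 2 * pi * m%:R = (pi *+ 2) *+ m :> R.
  by rewrite -[RHS]mulr_natr -(mulr_natr pi); ring.
elim: m x => [|m IH] x; first by rewrite addr0.
by rewrite mulrS addrA IH sinD2pi.
Qed.

Lemma cosDn2pi x m : cos (x + 2 * pi * m%:R) = cos x.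
Proof.
by rewrite -!sinDpihalf addrAC sinDn2pi.
Qed.

Lemma cosDz2pi x (z : int) : cos (x + 2 * pi * z%:~R) = cos x.
Proof.
case: z => n; first exact: cosDn2pi.
by rewrite NegzE mulrNz mulrN -[in RHS](subrK (2 * pi * n.+1%:R) x) cosDn2pi.
Qed.

(** Orthogonality of the characters of Z/H, with phi encoding both real and
    imaginary part: both ends of the telescoping sum differ by a full period. *)
Lemma cos_roots_sum_eq0 m H phi : (0 < m < H)%N ->
  \sum_(q < H) cos (2 * pi * (m%:R * (q%:R / H%:R)) + phi) = 0.
Proof.
move=> /andP[m0 mH]; have Hn : (0 < H)%N := ltn_trans m0 mH.
have H0 : 0 < H%:R :> R by rewrite ltr0n.
pose beta : R := pi * (m%:R / H%:R).
have sb : 0 < sin beta.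
  apply: sin_gt0_pi; rewrite /beta mulr_gt0 ?pi_gt0 ?divr_gt0 ?ltr0n//=.
  by rewrite gtr_pMr ?pi_gt0// ltr_pdivrMr// mul1r ltr_nat.
have := cos_sum_telescope beta phi H.
have -> : 2 * beta * H%:R + phi - beta = phi - beta + 2 * pi * m%:R.
  by rewrite /beta; field; rewrite gt_eqF.
rewrite sinDn2pi subrr => /eqP; rewrite !mulf_eq0 pnatr_eq0 (gt_eqF sb) /= => /eqP.
by move=> E; rewrite -[RHS]E; apply: eq_bigr => q _; congr cos; rewrite /beta; ring.
Qed.

Lemma norm_sin_le x : `|sin x| <= `|x|.
Proof.
wlog x0 : x / 0 < x => [hw|].
  have [x0|x0|->] := ltgtP x 0; [|exact: hw|by rewrite sin0].
  by rewrite -normrN -sinN -[leRHS]normrN; apply: hw; rewrite oppr_gt0.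
have [c _ E] := @MVT R sin cos 0 x x0 (fun y _ => is_derive_sin y)
  (continuous_subspaceT (@continuous_sin R)).
rewrite !subr0 sin0 subr0 in E.
by rewrite E normrM ler_piMl// cos_max.
Qed.

Lemma cos_lipschitz x y : `|cos x - cos y| <= `|x - y|.
Proof.
have -> : cos x - cos y = - (2 * sin ((x - y) / 2) * sin ((x + y) / 2)).
  have Ex : cos x = cos ((x + y) / 2 + (x - y) / 2) by congr cos; field.
  have Ey : cos y = cos ((x + y) / 2 - (x - y) / 2) by congr cos; field.
  by rewrite Ex Ey cosD cosB; ring.
rewrite normrN normrM; apply: le_trans (_ : `|2 * sin ((x - y) / 2)| <= _).
  by rewrite ler_piMr// sin_max.
rewrite normrM ger0_norm//; apply: le_trans (ler_wpM2l _ (norm_sin_le _)) _ => //.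
by rewrite normrM (ger0_norm (x := 2^-1))// mulrC divfK.
Qed.

End Trigonometry.

(** * Averages over windows *)

(** The pair (M, N) stands for the window {M + 1, ..., M + N}; along this filter
    N tends to infinity uniformly in the origin M, which is restricted to S. *)
Definition windows (S : set nat) : set_system (nat * nat) :=
  [set P | \forall N \near \oo, forall M, S M -> P (M, N)].

#[local] Instance windows_filter S : Filter (windows S).
Proof.
rewrite /windows; split=> /=; first exact: nearW.
- move=> P Q /=; apply: filterS2 => N hP hQ M SM; split; [exact: hP|exact: hQ].
- move=> P Q PQ /=; apply: filterS => N hN M SM; apply: PQ; exact: hN.
Qed.

Lemma near_windowsE S (P : nat * nat -> Prop) :
  (\forall p \near windows S, P p) =
  (\forall N \near \oo, forall M, S M -> P (M, N)).
Proof. by []. Qed.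

Lemma windows_ge S k : \forall p \near windows S, (k <= p.2)%N.
Proof.
by rewrite near_windowsE /=; near=> N => M _; near: N; exact: nbhs_infty_ge.
Unshelve. all: by end_near. Qed.

Section Mean.
Variable R : realType.
Implicit Types (f g : nat -> R) (p : nat * nat) (S : set nat).

Definition mean f p : R := (\sum_(i < p.2) f (p.1 + i).+1) / p.2%:R.

Lemma eq_mean f g p : f =1 g -> mean f p = mean g p.
Proof. by move=> fg; rewrite /mean; under eq_bigr do rewrite fg. Qed.

Lemma meanD f g p : mean (fun n => f n + g n) p = mean f p + mean g p.
Proof. by rewrite /mean big_split mulrDl. Qed.

Lemma meanZ (c : R) f p : mean (fun n => c * f n) p = c * mean f p.
Proof. by rewrite /mean -mulr_sumr mulrA. Qed.

Lemma meanB f g p : mean (fun n => f n - g n) p = mean f p - mean g p.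
Proof. by rewrite /mean sumrB mulrBl. Qed.

Lemma mean_cst (c : R) p : (0 < p.2)%N -> mean (fun=> c) p = c.
Proof.
move=> p0; rewrite /mean sumr_const card_ord -(mulr_natr c) mulfK//.
by rewrite pnatr_eq0 -lt0n.
Qed.

Lemma le_mean f g p : (forall n, f n <= g n) -> mean f p <= mean g p.
Proof.
by move=> fg; rewrite /mean ler_wpM2r ?invr_ge0//; apply: ler_sum => i _.
Qed.

Lemma norm_mean_le f p : `|mean f p| <= mean (fun n => `|f n|) p.
Proof.
rewrite /mean normrM normfV (ger0_norm (ler0n _ _)) ler_wpM2r ?invr_ge0//.
exact: ler_norm_sum.
Qed.

(** Jensen's inequality, as the nonnegativity of the variance. *)
Lemma mean_sqr_le f p : (mean f p) ^+ 2 <= mean (fun n => f n ^+ 2) p.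
Proof.
have [p0|p0] := posnP p.2.
  by rewrite /mean p0 invr0 !mulr0 expr0n.
have : 0 <= mean (fun n => (f n - mean f p) ^+ 2) p.
  rewrite mulr_ge0 ?invr_ge0//; apply: sumr_ge0 => i _; exact: sqr_ge0.
have E n : (f n - mean f p) ^+ 2
    = f n ^+ 2 - (2 * mean f p * f n - mean f p ^+ 2) by ring.
rewrite (eq_mean _ E) meanB meanB meanZ mean_cst//.
suff -> : 2 * mean f p * mean f p - mean f p ^+ 2 = mean f p ^+ 2.
  by rewrite subr_ge0.
by ring.
Qed.

Lemma cvg_mean_cst S (c : R) : mean (fun=> c) @ windows S --> c.
Proof.
apply: (@cvg_trans _ ((fun=> c) @ windows S)); last exact: cvg_cst.
apply: near_eq_cvg; near=> p; rewrite mean_cst//.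
by near: p; exact: windows_ge.
Unshelve. all: by end_near. Qed.

Lemma cvg_mean_lin S f g (a b c d : R) :
  mean f @ windows S --> a -> mean g @ windows S --> b ->
  mean (fun n => c * f n + d * g n) @ windows S --> c * a + d * b.
Proof.
move=> fa gb.
rewrite (_ : mean _ = (fun p => c * mean f p + d * mean g p)).
  by apply: cvgD; apply: cvgM => //; exact: cvg_cst.
by apply/funext => p; rewrite meanD !meanZ.
Qed.

Lemma cvg_mean_sum S (I : Type) (r : seq I) (P : pred I) (F : I -> nat -> R)
    (l : I -> R) :
  (forall i, P i -> mean (F i) @ windows S --> l i) ->
  mean (fun n => \sum_(i <- r | P i) F i n) @ windows S
    --> \sum_(i <- r | P i) l i.
Proof.
move=> Fl; elim: r => [|i r IH].
  rewrite big_nil (_ : (fun _ => _) = fun=> 0); first exact: cvg_mean_cst.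
  by apply/funext => n; rewrite big_nil.
rewrite big_cons; case: ifPn => Pi; last first.
  rewrite (_ : (fun _ => _) = fun n => \sum_(i <- r | P i) F i n)//.
  by apply/funext => n; rewrite big_cons (negPf Pi).
rewrite -[l i]mul1r -[X in _ + X]mul1r.
rewrite (_ : (fun _ => _) = fun n => 1 * F i n + 1 * \sum_(i <- r | P i) F i n).
  by apply: cvg_mean_lin => //; exact: Fl.
by apply/funext => n; rewrite big_cons Pi !mul1r.
Qed.

(** Convergence of rate B / N holds along every family of windows, as the bound
    does not see the origin. *)
Lemma cvg_windows_bound S (F : nat * nat -> R) (l B : R) :
  (forall p, (0 < p.2)%N -> `|l - F p| <= B / p.2%:R) -> F @ windows S --> l.
Proof.
move=> FB; apply/cvgrPdist_lt => e e0; near=> p.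
have p0 : (0 < p.2)%N by near: p; exact: windows_ge.
apply: le_lt_trans (FB p p0) _.
rewrite ltr_pdivrMr ?ltr0n// -ltr_pdivrMl//.
apply: lt_le_trans (truncnS_gt _) _; rewrite ler_nat.
by near: p; exact: windows_ge.
Unshelve. all: by end_near. Qed.

(** Means of bounded sequences are asymptotically shift invariant: translating
    a window by one only exchanges two boundary terms. *)
Lemma cvg_mean_shiftB S f (B : R) h : (forall n, `|f n| <= B) ->
  mean (fun n => f (n + h)%N - f n) @ windows S --> 0.
Proof.
move=> fB; elim: h => [|h IH].
  rewrite (_ : (fun _ => _) = fun=> 0); first exact: cvg_mean_cst.
  by apply/funext => n; rewrite addn0 subrr.
pose g n := f (n + h)%N.
rewrite (_ : mean _ = fun p => mean (fun n => g n - f n) p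
                             + mean (fun n => g n.+1 - g n) p); last first.
  apply/funext => p; rewrite -meanD; apply: eq_mean => n.
  by rewrite /g addSnnS [RHS]addrC subrKA.
rewrite -[0]addr0; apply: cvgD => //.
apply: (@cvg_windows_bound _ _ _ (B + B)) => -[M N] /= _.
rewrite sub0r normrN /mean normrM normfV (ger0_norm (ler0n _ _)).
rewrite ler_wpM2r ?invr_ge0//=.
rewrite -(big_mkord xpredT (fun i => g (M + i).+2 - g (M + i).+1)).
rewrite (@telescope_sumr_eq _ 0%N N (fun i => g (M + i).+1))//; last first.
  by move=> k _; rewrite addnS.
by apply: le_trans (ler_normB _ _) _; rewrite lerD// fB.
Qed.

Lemma cvg_mean_shift S f (B l : R) h : (forall n, `|f n| <= B) ->
  mean f @ windows S --> l -> mean (fun n => f (n + h)%N) @ windows S --> l.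
Proof.
move=> fB fl; rewrite -[l]add0r.
rewrite (_ : mean _ = fun p => mean (fun n => f (n + h)%N - f n) p + mean f p).
  by apply: cvgD => //; exact: cvg_mean_shiftB fB.
by apply/funext => p; rewrite -meanD; apply: eq_mean => n; rewrite subrK.
Qed.

End Mean.

(** * Mean squares and correlations *)

Section Gram.
Variable R : realType.

(** The identity |sum of e(a_h)|^2 = sum of e(a_h - a_k) in real form; the
    imaginary parts cancel by symmetry. *)
Lemma sqr_cos_sin_sum (H : nat) (a : 'I_H -> R) :
  (\sum_(h < H) cos (a h)) ^+ 2 + (\sum_(h < H) sin (a h)) ^+ 2 =
  \sum_(h < H) \sum_(k < H) cos (a h - a k).
Proof.
rewrite !expr2 !big_distrlr -big_split; apply: eq_bigr => h _ /=.
by rewrite -big_split; apply: eq_bigr => k _; rewrite cosB.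
Qed.

(** When all off-diagonal correlations average to zero, the mean square of the
    sum of H unit vectors is H, the contribution of the diagonal, instead of the
    trivial H^2. It serves both van der Corput's theorem and the mean of the
    Fejer kernel along a sequence. *)
Lemma cvg_mean_gram S (H : nat) (a : 'I_H -> nat -> R) :
  (forall h k : 'I_H, (k < h)%N ->
     mean (fun n => cos (a h n - a k n)) @ windows S --> 0) ->
  mean (fun n => (\sum_(h < H) cos (a h n)) ^+ 2
                 + (\sum_(h < H) sin (a h n)) ^+ 2) @ windows S --> (H%:R : R).
Proof.
move=> off.
rewrite (_ : (fun _ => _) =
    fun n => \sum_(h < H) \sum_(k < H) cos (a h n - a k n)); last first.
  by apply/funext => n; rewrite (sqr_cos_sin_sum (fun h => a h n)).
rewrite (_ : H%:R = \sum_(h < H) \sum_(k < H) (h == k)%:R); last first.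
  rewrite (eq_bigr (fun=> 1)) ?sumr_const ?card_ord// => h _.
  rewrite (bigD1 h)//= eqxx big1 ?addr0// => k /negPf.
  by rewrite eq_sym => ->.
apply: cvg_mean_sum => h _; apply: cvg_mean_sum => k _.
have [hk|kh|/val_inj ->] := ltngtP h k.
- rewrite (_ : (h == k) = false); last by apply/eqP => E; rewrite E ltnn in hk.
  rewrite (_ : (fun _ => _) = fun n => cos (a k n - a h n)); first exact: off.
  by apply/funext => n; rewrite -cosN opprB.
- rewrite (_ : (h == k) = false); last by apply/eqP => E; rewrite E ltnn in kh.
  exact: off.
rewrite eqxx (_ : (fun _ => _) = fun=> 1); first exact: cvg_mean_cst.
by apply/funext => n; rewrite subrr cos0.
Qed.

End Gram.

(** * Equidistributed sequences have vanishing Weyl sums *)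

Section Weyl.
Variable R : realType.
Implicit Types (S : set nat) (x : nat -> torus R) (y t phi c d delta : R).

Definition ico_ind (a b t : R) : R := (a <= t < b)%R%:R.

Definition equidistributed S x : Prop :=
  forall a b : R, 0 <= a -> a < b -> b <= 1 ->
    mean (fun n => ico_ind a b (x n)) @ windows S --> b - a.

(** The real part of e(m t) times the unit complex number of argument phi. *)
Definition wave (m : nat) phi t : R := cos (2 * pi * (m%:R * t) + phi).

Definition weyl_sums_vanish S x := forall m phi, (0 < m)%N ->
  mean (fun n => wave m phi (x n)) @ windows S --> 0.

Lemma wave_lipschitz m phi y t :
  `|wave m phi y - wave m phi t| <= 2 * pi * m%:R * `|y - t|.
Proof.
apply: le_trans (cos_lipschitz _ _) _.
rewrite (_ : _ - _ = 2 * pi * m%:R * (y - t)); last by ring.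
by rewrite normrM ger0_norm// !mulr_ge0// pi_ge0.
Qed.

(** The indicator of a cell is the difference of the indicators of two
    half-lines, so the sum telescopes. *)
Lemma cells_sum (Q : nat) y : (0 < Q)%N -> 0 <= y < 1 ->
  \sum_(q < Q) ico_ind (q%:R / Q%:R) (q.+1%:R / Q%:R) y = 1.
Proof.
move=> Q0 /andP[y0 y1].
rewrite -(big_mkord xpredT (fun q => ico_ind (q%:R / Q%:R) (q.+1%:R / Q%:R) y)).
rewrite (@telescope_sumr_eq _ 0%N Q (fun q => (y < q%:R / Q%:R)%R%:R))//; last first.
  move=> q _; rewrite /ico_ind; case: (ltP y (q%:R / Q%:R)) => [yq|_] /=;
    last by rewrite subr0.
  rewrite (lt_le_trans yq) ?subrr// ler_wpM2r ?invr_ge0// ler_nat; lia.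
by rewrite divff ?pnatr_eq0 -?lt0n// y1 mul0r ltNge y0 subr0.
Qed.

(** On the grid of mesh 1/Q the wave is uniformly close to a step function,
    whose mean tends to its sum over the grid divided by Q; that sum is 0 by
    orthogonality as soon as m < Q. *)
Lemma equidistributed_wave S x : equidistributed S x -> weyl_sums_vanish S x.
Proof.
move=> xS m phi m0; apply/cvgrPdist_lt => e e0.
(* Q > m for orthogonality, and mesh fine enough for the Lipschitz bound. *)
pose Q := (maxn m (Num.truncn (2 * pi * m%:R / (e / 2)))).+1.
have mQ : (m < Q)%N by rewrite ltnS leq_maxl.
have Q0 : 0 < Q%:R :> R by rewrite ltr0n.
have eQ : 2 * pi * m%:R / Q%:R < e / 2.
  rewrite ltr_pdivrMr// -ltr_pdivrMl ?divr_gt0// mulrC.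
  apply: lt_le_trans (truncnS_gt _) _; rewrite ler_nat ltnS; exact: leq_maxr.
pose cell (q : nat) t : R := ico_ind (q%:R / Q%:R) (q.+1%:R / Q%:R) t.
pose step t := \sum_(q < Q) wave m phi (q%:R / Q%:R) * cell q t.
have step_close n : `|wave m phi (x n) - step (x n)| <= e / 2.
  have cells1 := @cells_sum Q (x n) isT (torus_valP (x n)).
  rewrite -[X in `|X - _|]mulr1 -[X in `|_ * X - _|]cells1.
  rewrite mulr_sumr -sumrB; apply: le_trans (ler_norm_sum _ _ _) _.
  rewrite -[leRHS]mulr1 -[X in _ <= _ * X]cells1.
  rewrite mulr_sumr; apply: ler_sum => q _; rewrite /cell -mulrBl normrM.
  rewrite /ico_ind (ger0_norm (ler0n _ _)).
  case: (boolP (_ <= _ < _)) => [/andP[qx xq]|_]; last by rewrite !mulr0.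
  rewrite !mulr1; apply: le_trans (wave_lipschitz _ _ _ _) _.
  apply: le_trans (ltW eQ).
  rewrite ler_wpM2l ?mulr_ge0 ?pi_ge0// ger0_norm ?subr_ge0//.
  rewrite lerBlDr -{1}[Q%:R^-1]mul1r -mulrDl addrC natr1; exact: ltW.
have step0 : mean (fun n => step (x n)) @ windows S --> 0.
  rewrite (_ : 0 = \sum_(q < Q) wave m phi (q%:R / Q%:R) * Q%:R^-1); last first.
    by rewrite -mulr_suml cos_roots_sum_eq0 ?mul0r ?m0.
  apply: cvg_mean_sum => q _.
  rewrite (_ : mean _ = fun p => wave m phi (q%:R / Q%:R)
                               * mean (fun n => cell q (x n)) p); last first.
    by apply/funext => p; rewrite meanZ.
  apply: cvgM; first exact: cvg_cst.
  rewrite (_ : Q%:R^-1 = q.+1%:R / Q%:R - q%:R / Q%:R); last first.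
    by rewrite -mulrBl -natr1 addrAC subrr add0r mul1r.
  apply: xS; first by rewrite divr_ge0.
  - by rewrite ltr_pM2r ?invr_gt0// ltr_nat.
  - by rewrite ler_pdivrMr// mul1r ler_nat.
move/cvgrPdist_lt : step0 => /(_ (e / 2)) /(_ (divr_gt0 e0 (ltr0Sn _ 1))) step0.
near=> p; rewrite sub0r normrN.
have p0 : (0 < p.2)%N by near: p; exact: windows_ge.
have -> : mean (fun n => wave m phi (x n)) p =
    mean (fun n => wave m phi (x n) - step (x n)) p + mean (fun n => step (x n)) p.
  by rewrite meanB subrK.
apply: le_lt_trans (ler_normD _ _) _.
rewrite [ltRHS](splitr e); apply: ler_ltD.
  apply: le_trans (norm_mean_le _ _) _.
  by rewrite -[leRHS](mean_cst _ p0); apply: le_mean.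
by rewrite -normrN -sub0r; near: p.
Unshelve. all: by end_near. Qed.

End Weyl.

(** * The Fejer kernel on a grid *)

Section Fejer.
Variable R : realType.
Implicit Types (S : set nat) (x : nat -> torus R) (y t phi c d delta : R).

(** The square |sum of e(h t) over h < H|^2 divided by H^2: the Fejer kernel,
    normalized so that its translates by the grid of mesh 1/H form a partition of
    unity ([fejer_sum]). *)
Definition fejer (H : nat) t : R :=
  ((\sum_(h < H) cos (2 * (pi * t) * h%:R)) ^+ 2
   + (\sum_(h < H) sin (2 * (pi * t) * h%:R)) ^+ 2) / H%:R ^+ 2.

Lemma fejer_ge0 H t : 0 <= fejer H t.
Proof. by rewrite divr_ge0 ?addr_ge0 ?sqr_ge0. Qed.

Lemma sqr_far (a s z : R) : 0 < s -> s <= `|a| -> `|a| * `|z| <= 1 ->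
  z ^+ 2 <= s ^- 2.
Proof.
move=> s0 sa az; rewrite -real_normK ?num_real// -exprVn.
rewrite lerXn2r ?nnegrE ?invr_ge0 ?(ltW s0)//.
rewrite -[leRHS]mulr1 ler_pdivlMl//; apply: le_trans az.
by rewrite ler_wpM2r.
Qed.

Lemma fejer_far H t (s : R) : 0 < s -> s <= `|sin (pi * t)| ->
  fejer H t <= 2 / s ^+ 2 / H%:R ^+ 2.
Proof.
move=> s0 st; rewrite /fejer ler_wpM2r ?invr_ge0 ?sqr_ge0//.
rewrite (_ : 2 / s ^+ 2 = s ^- 2 + s ^- 2); last by rewrite mulr_natl mulr2n.
apply: lerD; apply: (sqr_far s0 st).
- have := norm_cos_sum_le (pi * t) 0 H.
  by under eq_bigr do rewrite addr0.
- have := norm_cos_sum_le (pi * t) (- (pi / 2)) H.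
  by under eq_bigr do rewrite cosBpihalf.
Qed.

(** Expanding the square, the terms with h <> k vanish by orthogonality on the
    grid, and the H diagonal terms contribute H each. Interpolating on the grid
    thus does the work of convolution with the kernel, without integrals. *)
Lemma fejer_sum H y : (0 < H)%N -> \sum_(q < H) fejer H (y - q%:R / H%:R) = 1.
Proof.
move=> H0; have Hn0 : H%:R != 0 :> R by rewrite pnatr_eq0 -lt0n.
rewrite /fejer -mulr_suml.
apply: (canLR (mulfK _)); rewrite ?expf_neq0// mul1r.
under eq_bigr do rewrite (sqr_cos_sin_sum (fun h : 'I_H => _ * h%:R)).
rewrite exchange_big /=.
transitivity (\sum_(h < H) H%:R : R); last first.
  by rewrite sumr_const card_ord -(mulr_natr H%:R) expr2.
have off (h k : 'I_H) : (k < h)%N -> \sum_(q < H)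
    cos (2 * (pi * (y - q%:R / H%:R)) * h%:R
         - 2 * (pi * (y - q%:R / H%:R)) * k%:R) = 0.
  pose phi := - (2 * pi * ((h - k)%:R * y)).
  move=> kh; rewrite -[RHS](@cos_roots_sum_eq0 R (h - k)%N H phi).
    by apply: eq_bigr => q _; rewrite -cosN /phi natrB ?(ltnW kh)//;
      congr cos; ring.
  by rewrite subn_gt0 kh (leq_ltn_trans (leq_subr _ _)).
apply: eq_bigr => h _; rewrite exchange_big (bigD1 h)//=.
rewrite [X in X + _](eq_bigr (fun=> 1)) => [|q _]; last by rewrite subrr cos0.
rewrite sumr_const card_ord big1 ?addr0// => k kh.
have [lt|lt|/val_inj E] := ltngtP k h; [exact: off| |by rewrite E eqxx in kh].
by rewrite -[RHS](off _ _ lt); apply: eq_bigr => q _; rewrite -cosN opprB.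
Qed.

(** The same expansion, with the average over the grid replaced by the average
    along the sequence. *)
Lemma cvg_mean_fejer S x H y : weyl_sums_vanish S x ->
  mean (fun n => fejer H ((x n : R) - y)) @ windows S --> (H%:R^-1 : R).
Proof.
move=> xS; have [->|H0] := posnP H.
  rewrite invr0 (_ : (fun _ => _) = fun=> 0); first exact: cvg_mean_cst.
  by apply/funext => n; rewrite /fejer !expr2 mul0r invr0 mulr0.
have Hn0 : H%:R != 0 :> R by rewrite pnatr_eq0 -lt0n.
rewrite (_ : mean _ = fun p => H%:R ^- 2 * mean (fun n =>
  (\sum_(h < H) cos (2 * (pi * ((x n : R) - y)) * h%:R)) ^+ 2
   + (\sum_(h < H) sin (2 * (pi * ((x n : R) - y)) * h%:R)) ^+ 2) p); last first.
  by apply/funext => p; rewrite -meanZ; apply: eq_mean => n; rewrite mulrC.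
rewrite (_ : H%:R^-1 = H%:R ^- 2 * H%:R); last by field.
apply: cvgM; first exact: cvg_cst.
apply: (cvg_mean_gram (a := fun h n => 2 * (pi * ((x n : R) - y)) * h%:R)) => h k kh.
rewrite (_ : (fun _ => _) =
   fun n => wave (h - k) (- (2 * pi * ((h - k)%:R * y))) (x n)).
  by apply: xS; rewrite subn_gt0.
by apply/funext => n; congr cos; rewrite natrB ?(ltnW kh)//; ring.
Qed.

(** The hypotheses say that t is at distance at least delta from 0 on the
    circle, and |sin (pi t)| increases with that distance. *)
Lemma sin_pi_far delta t : 0 < delta -> delta <= 2^-1 ->
  delta <= `|t| -> `|t| <= 1 - delta -> sin (pi * delta) <= `|sin (pi * t)|.
Proof.
move=> d0 d2.
wlog t0 : t / 0 <= t => [hw|].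
  have [t0|t0] := leP 0 t; first exact: hw.
  by rewrite -normrN -[`|sin _|]normrN -sinN -mulrN; apply: hw; rewrite oppr_ge0 ltW.
rewrite (ger0_norm t0) => dt td; apply: le_trans (ler_norm _).
have pi0 := pi_gt0 R.
wlog t2 : t t0 dt td / t <= 2^-1 => [hw|].
  have [t2|t2] := leP t 2^-1; first exact: hw.
  have -> : sin (pi * t) = sin (pi * (1 - t)).
    by rewrite mulrBr mulr1 addrC sinDpi sinN opprK.
  by apply: hw; lra.
have itv (z : R) : 0 < z -> z <= 2^-1 -> pi * z \in `[- (pi / 2), pi / 2].
  move=> z0 z2; rewrite in_itv /=; apply/andP; split; last first.
    by rewrite ler_wpM2l// pi_ge0.
  apply: (@le_trans _ _ 0); first by rewrite oppr_le0 divr_ge0// ltW.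
  by rewrite mulr_ge0// ltW.
move: dt; rewrite le_eqVlt => /predU1P[->//|dt].
by apply/ltW; rewrite ltr_sin ?ltr_pM2l// itv//; lra.
Qed.

(** The function t |-> min (max (t, c), d + 1) is nondecreasing with values in
    [c, d + 1] and increases by 1 from q to q + 1 whenever q lies in [c, d]. *)
Lemma count_itv_le (N : nat) c d : c <= d ->
  \sum_(q < N) (c <= q%:R <= d)%R%:R <= d - c + 1.
Proof.
move=> cd; pose clamp (t : R) := Num.min (Num.max t c) (d + 1).
have clamp_itv t : c <= clamp t <= d + 1.
  by rewrite /clamp le_min ge_min le_max !lexx !orbT/= andbT; lra.
apply: (@le_trans _ _ (\sum_(q < N) (clamp q.+1%:R - clamp q%:R))).
  apply: ler_sum => q _; rewrite -natr1 /clamp.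
  case: (boolP (_ <= _ <= _)) => [/andP[cq qd]|_] /=.
    rewrite (max_l cq) max_l ?min_l; lra.
  rewrite subr_ge0; case: (leP q%:R c) => ?; case: (leP (q%:R + 1) c) => ?;
    case: (leP c (d + 1)) => ?; case: (leP q%:R (d + 1)) => ?;
    case: (leP (q%:R + 1) (d + 1)) => ?; lra.
rewrite -(big_mkord xpredT (fun q => clamp q.+1%:R - clamp q%:R)) telescope_sumr//.
by have := clamp_itv N%:R; have := clamp_itv 0%:R; lra.
Qed.

End Fejer.

(** * Vanishing Weyl sums imply equidistribution *)

Section WeylConverse.
Variable R : realType.
Implicit Types (S : set nat) (x : nat -> torus R) (a b y t phi c d delta : R).

(** The delta-neighbourhood of [a, b) on the circle, enlarged by
    delta-neighbourhoods of 0 on both sides so that no case distinction on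
    wrapping around is required. *)
Definition near_arc a b delta t : bool :=
  [|| a - delta <= t <= b + delta, 0 <= t <= delta | 1 - delta <= t <= 1].

(** For y in [a, b) the kernels centred at the grid points sum to 1, and the
    centres outside the neighbourhood contribute at most H times the value
    allowed by [fejer_far]. *)
Lemma ico_ind_le_fejer a b delta H y : 0 < delta -> delta <= 2^-1 ->
  (0 < H)%N -> 0 <= y < 1 ->
  ico_ind a b y <=
    \sum_(q < H | near_arc a b delta (q%:R / H%:R)) fejer H (y - q%:R / H%:R)
    + 2 / sin (pi * delta) ^+ 2 / H%:R.
Proof.
move=> d0 d2 H0 /andP[y0 y1]; have Hp : 0 < H%:R :> R by rewrite ltr0n.
rewrite /ico_ind; case: (boolP (_ <= _ < _)) => [/andP[ay yb]|_] /=; last first.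
  by rewrite addr_ge0 ?divr_ge0 ?sqr_ge0// sumr_ge0// => q _; exact: fejer_ge0.
rewrite -[leLHS](fejer_sum y H0).
rewrite (bigID (fun q : 'I_H => near_arc a b delta (q%:R / H%:R))) /= lerD2l.
set s := sin (pi * delta).
have s0 : 0 < s.
  have pi0 := pi_gt0 R; apply: sin_gt0_pi; rewrite mulr_gt0//= gtr_pMr//; lra.
apply: (@le_trans _ _ (\sum_(q < H) 2 / s ^+ 2 / H%:R ^+ 2)); last first.
  rewrite sumr_const card_ord -(mulr_natr (_ / _)) (expr2 H%:R) (invfM H%:R).
  by rewrite mulrA divfK ?gt_eqF.
rewrite [leRHS](bigID (fun q : 'I_H => near_arc a b delta (q%:R / H%:R))) /=.
rewrite -[leLHS]add0r; apply: lerD.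
  by apply: sumr_ge0 => q _; rewrite !divr_ge0 ?sqr_ge0.
apply: ler_sum => q; rewrite !negb_or => /and3P[n1 n2 n3].
have q0 : 0 <= q%:R / H%:R :> R by rewrite divr_ge0.
have q1 : q%:R / H%:R <= 1 :> R by rewrite ler_pdivrMr// mul1r ler_nat ltnW.
apply: fejer_far => //; apply: sin_pi_far => //; move: (_ / _) q0 q1 n1 n2 n3 => t.
- by move=> q0 q1 n1 n2 n3; case: (ger0P (y - t)) => ?; lra.
- by move=> q0 q1 n1 n2 n3; case: (ger0P (y - t)) => ?; lra.
Qed.

Lemma near_arc_count a b delta H : a <= b -> 0 < delta -> (0 < H)%N ->
  \sum_(q < H | near_arc a b delta (q%:R / H%:R)) H%:R^-1
    <= b - a + 4 * delta + 3 / H%:R.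
Proof.
move=> ab d0 H0; have Hp : 0 < H%:R :> R by rewrite ltr0n.
pose itv c d (q : nat) : R := (c * H%:R <= q%:R <= d * H%:R)%R%:R.
apply: (@le_trans _ _ (H%:R^-1 * \sum_(q < H) (itv (a - delta) (b + delta) q
   + itv 0 delta q + itv (1 - delta) 1 q))).
  rewrite mulr_sumr big_mkcond /=; apply: ler_sum => q _.
  have itvE c d : (c <= q%:R / H%:R <= d) = (c * H%:R <= q%:R <= d * H%:R).
    by rewrite ler_pdivlMr// ler_pdivrMr.
  have : 0 < H%:R^-1 :> R by rewrite invr_gt0.
  rewrite /near_arc !itvE /itv.
  by case: (_ <= _ <= _); case: (_ <= _ <= _); case: (_ <= _ <= _) => /=; lra.
have itv_sum c d : c <= d -> \sum_(q < H) itv c d q <= (d - c) * H%:R + 1.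
  by move=> cd; rewrite mulrBl; apply: count_itv_le; rewrite ler_wpM2r.
rewrite !big_split /= mulrC ler_pdivrMr// !mulrDl divfK ?gt_eqF//.
have := itv_sum (a - delta) (b + delta); have := itv_sum 0 delta.
have := itv_sum (1 - delta) 1; nra.
Qed.

(** The majorant of [ico_ind_le_fejer] has a mean close to the proportion of
    grid points in the neighbourhood, hence to b - a. *)
Lemma ico_mean_limsup_le S x a b (e : R) : weyl_sums_vanish S x ->
  a <= b -> 0 < e ->
  \forall p \near windows S, mean (fun n => ico_ind a b (x n)) p <= b - a + e.
Proof.
move=> xS ab e0.
(* The error consists of 4 delta <= e / 4 from the size of the neighbourhood, of
   He below from counting and from the far centres, and of e / 4 from the
   convergence of the mean. *)
pose delta := Num.min 2^-1 (e / 16).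
have d0 : 0 < delta by rewrite lt_min invr_gt0 ltr0Sn divr_gt0.
have [d2 de] : delta <= 2^-1 /\ delta <= e / 16 by rewrite !ge_min !lexx orbT.
set s := sin (pi * delta).
have s0 : 0 < s.
  have pi0 := pi_gt0 R; apply: sin_gt0_pi; rewrite mulr_gt0//= gtr_pMr//; lra.
pose H := (Num.truncn ((3 + 2 / s ^+ 2) / (e / 4))).+1.
have Hp : 0 < H%:R :> R by rewrite ltr0n.
have He : 3 / H%:R + 2 / s ^+ 2 / H%:R <= e / 4.
  rewrite -mulrDl ler_pdivrMr// -ler_pdivrMl ?divr_gt0// mulrC.
  exact: ltW (truncnS_gt _).
pose g y := \sum_(q < H | near_arc a b delta (q%:R / H%:R))
  fejer H (y - q%:R / H%:R).
have gl : mean (fun n => g (x n)) @ windows S -->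
    \sum_(q < H | near_arc a b delta (q%:R / H%:R)) (H%:R^-1 : R).
  by apply: cvg_mean_sum => q _; exact: cvg_mean_fejer.
have count := near_arc_count ab d0 (isT : 0 < H)%N.
move/cvgrPdist_lt : gl => /(_ (e / 4)) /(_ (divr_gt0 e0 (ltr0Sn _ 3))) gl.
near=> p; have p0 : (0 < p.2)%N by near: p; exact: windows_ge.
have le1 : mean (fun n => ico_ind a b (x n)) p
    <= mean (fun n => g (x n)) p + 2 / s ^+ 2 / H%:R.
  rewrite -[X in _ + X](mean_cst _ p0) -meanD; apply: le_mean => n.
  by apply: ico_ind_le_fejer => //; exact: torus_valP.
have : `|\sum_(q < H | near_arc a b delta (q%:R / H%:R)) (H%:R^-1 : R)
        - mean (fun n => g (x n)) p| < e / 4 by near: p.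
rewrite ltr_norml => /andP[? ?]; lra.
Unshelve. all: by end_near. Qed.

(** The upper bounds for [0, a), [a, b) and [b, 1) add up to 1 up to a small
    error, so each of them is also a lower bound. *)
Lemma weyl_criterion S x : weyl_sums_vanish S x -> equidistributed S x.
Proof.
move=> xS a b a0 ab b1; apply/cvgrPdist_le => e e0.
have e2 : 0 < e / 2 by rewrite divr_gt0.
near=> p.
have p0 : (0 < p.2)%N by near: p; exact: windows_ge.
have up : mean (fun n => ico_ind a b (x n)) p <= b - a + e / 2.
  by near: p; exact: ico_mean_limsup_le xS (ltW ab) e2.
have lo1 : mean (fun n => ico_ind 0 a (x n)) p <= a - 0 + e / 2.
  by near: p; exact: ico_mean_limsup_le xS a0 e2.
have lo2 : mean (fun n => ico_ind b 1 (x n)) p <= 1 - b + e / 2.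
  by near: p; exact: ico_mean_limsup_le xS b1 e2.
have tot : mean (fun n => ico_ind 0 a (x n)) p + mean (fun n => ico_ind a b (x n)) p
    + mean (fun n => ico_ind b 1 (x n)) p = 1.
  rewrite -!meanD -[RHS](mean_cst 1 p0); apply: eq_mean => n.
  have /andP[y0 y1] := torus_valP (x n); rewrite /ico_ind y0 y1 andbT /=.
  case: (ltP (x n : R) a) => [xa|ax] /=.
    by rewrite leNgt (lt_trans xa ab) !addr0.
  by case: leP => _; rewrite ?addr0 ?add0r.
by rewrite ler_norml; apply/andP; split; lra.
Unshelve. all: by end_near. Qed.

End WeylConverse.

(** * Van der Corput's difference theorem *)

Section VanDerCorput.
Variable R : realType.
Implicit Types (S : set nat) (theta : nat -> R).

(** Up to an error that vanishes in the limit, the mean of cos theta_n is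
    the mean of its moving averages of length H. By Jensen its square is at most
    the mean square modulus of the moving averages of exp (i theta_n), which
    tends to 1/H because the correlations vanish. *)
Lemma van_der_corput S theta :
  (forall h, (0 < h)%N ->
     mean (fun n => cos (theta (n + h)%N - theta n)) @ windows S --> 0) ->
  mean (fun n => cos (theta n)) @ windows S --> 0.
Proof.
move=> corr; apply/cvgrPdist_lt => e e0.
have e20 : 0 < (e / 2) ^+ 2 by rewrite exprn_gt0// divr_gt0.
(* The mean square of the unnormalized moving sums is eventually below 2 H,
   so H must satisfy 2 H < (H e / 2)^2. *)
pose H := (Num.truncn (2 / (e / 2) ^+ 2)).+1.
have Hp : 0 < H%:R :> R by rewrite ltr0n.
have He : 2 < (e / 2) ^+ 2 * H%:R by rewrite mulrC -ltr_pdivrMr// truncnS_gt.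
pose C n := \sum_(h < H) cos (theta (n + h)%N).
pose D n := \sum_(h < H) sin (theta (n + h)%N).
have CD : mean (fun n => C n ^+ 2 + D n ^+ 2) @ windows S --> (H%:R : R).
  apply: (cvg_mean_gram (a := fun (h : 'I_H) n => theta (n + h)%N)) => h k kh.
  (* The (h, k) correlation is the (h - k)-th one shifted by k. *)
  pose f m := cos (theta (m + (h - k))%N - theta m).
  rewrite (_ : (fun _ => _) = fun n => f (n + k)%N).
    apply: (@cvg_mean_shift _ S f 1) => [n|]; first exact: cos_max.
    by apply: corr; rewrite subn_gt0.
  by apply/funext => n; rewrite /f -addnA subnKC// ltnW.
have shifts : mean (fun n => \sum_(h < H) (cos (theta (n + h)%N) - cos (theta n)))
    @ windows S --> 0.
  rewrite [X in _ --> X](_ : _ = \sum_(h < H) (0 : R)); last by rewrite big1.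
  apply: cvg_mean_sum => h _.
  by apply: (@cvg_mean_shiftB _ _ (fun n => cos (theta n)) 1) => n; exact: cos_max.
move/cvgrPdist_lt : CD => /(_ H%:R Hp) CD.
have eH : 0 < e / 2 * H%:R by rewrite mulr_gt0// divr_gt0.
move/cvgrPdist_lt : shifts => /(_ _ eH) shifts.
near=> p; have p0 : (0 < p.2)%N by near: p; exact: windows_ge.
have shp : `|mean C p - H%:R * mean (fun n => cos (theta n)) p| < e / 2 * H%:R.
  rewrite -meanZ -meanB (_ : mean _ p =
    mean (fun n => \sum_(h < H) (cos (theta (n + h)%N) - cos (theta n))) p).
    by rewrite -normrN -sub0r; near: p.
  by apply: eq_mean => n; rewrite sumrB sumr_const card_ord mulr_natl.
have CDp : `|H%:R - mean (fun n => C n ^+ 2 + D n ^+ 2) p| < H%:R by near: p.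
have Cp : `|mean C p| < e / 2 * H%:R.
  rewrite -ltr_sqr ?nnegrE ?(ltW eH)// real_normK ?num_real//.
  apply: (@le_lt_trans _ _ (mean (fun n => C n ^+ 2 + D n ^+ 2) p)).
    apply: le_trans (mean_sqr_le _ _) _; apply: le_mean => n.
    by rewrite lerDl sqr_ge0.
  apply: (@lt_le_trans _ _ (2 * H%:R)).
    by move: CDp; rewrite ltr_norml => /andP[? ?]; lra.
  by rewrite exprMn expr2 mulrA ler_wpM2r// ltW.
rewrite sub0r normrN -(ltr_pM2l Hp) -{1}(gtr0_norm Hp) -normrM.
rewrite -[H%:R * mean _ _](subKr (mean C p)).
apply: le_lt_trans (ler_normB _ _) _; lra.
Unshelve. all: by end_near. Qed.

End VanDerCorput.

(** * Averages of trigonometric polynomials *)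

Section TrigonometricPolynomials.
Variable R : realType.
Implicit Types (S A : set nat) (omega phi : R).

(** Either omega is a multiple of 2 pi and the sequence is constant, or its sums
    over windows are bounded. *)
Lemma cvg_mean_cos S omega phi :
  exists l : R, mean (fun n => cos (omega * n%:R + phi)) @ windows S --> l.
Proof.
pose beta := omega / 2; have ->: omega = 2 * beta by rewrite /beta; field.
have [sb|sb] := eqVneq (sin beta) 0.
  exists (cos phi); rewrite (_ : (fun _ => _) = fun=> cos phi).
    exact: cvg_mean_cst.
  apply/funext; elim=> [|n IH]; first by rewrite mulr0 add0r.
  have -> : 2 * beta * n.+1%:R + phi = 2 * beta * n%:R + phi + beta + beta.
    by rewrite -natr1; ring.
  rewrite -[RHS]IH cosD (cosD _ beta) (sinD _ beta) sb !mulr0 !subr0.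
  by rewrite -mulrA -expr2 cos2sin2 sb expr0n subr0 mulr1.
exists 0; apply: (@cvg_windows_bound _ _ _ _ (`|sin beta|^-1)) => -[M N] /= N0.
rewrite sub0r normrN /mean normrM normfV (ger0_norm (ler0n _ _)).
rewrite ler_wpM2r ?invr_ge0//= -[leRHS]mulr1 ler_pdivlMl ?normr_gt0//.
have := norm_cos_sum_le beta (2 * beta * M.+1%:R + phi) N.
congr (_ * `|_| <= 1); apply: eq_bigr => i _; congr cos.
by rewrite -addSn natrD; ring.
Qed.

Lemma Re_trig_poly k (alpha : 'I_k -> torus R) (c : 'I_k -> R[i]) n :
  complex.Re (trig_poly alpha c n) =
  \sum_(j < k) (complex.Re (c j) * cos (2 * pi * (alpha j : R) * n%:R + 0)
    + complex.Im (c j) * cos (2 * pi * (alpha j : R) * n%:R + pi / 2)).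
Proof.
have ReD : {morph (@complex.Re R) : y z / y + z >-> y + z} by case=> ? ? [].
rewrite /trig_poly (big_morph _ ReD (id1 := 0))//; apply: eq_bigr => j _.
by rewrite addr0 cosDpihalf; case: (c j) => a b /=; rewrite mulrN.
Qed.

(** Linearity transfers a limit for every frequency to trigonometric polynomials.
    The explicit value of the limit is used with l = 0, its existence with the
    weight w = 1. *)
Lemma cvg_mean_trig_poly S (w : nat -> R) (l : R -> R -> R)
    k (alpha : 'I_k -> torus R) (c : 'I_k -> R[i]) :
  (forall omega phi,
     mean (fun n => cos (omega * n%:R + phi) * w n) @ windows S --> l omega phi) ->
  exists L : R,
    L = \sum_(j < k) (complex.Re (c j) * l (2 * pi * (alpha j : R)) 0
                   + complex.Im (c j) * l (2 * pi * (alpha j : R)) (pi / 2)) /\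
    mean (fun n => complex.Re (trig_poly alpha c n) * w n) @ windows S --> L.
Proof.
move=> wl; eexists; split; first by [].
rewrite (_ : (fun _ => _) = fun n => \sum_(j < k)
   (complex.Re (c j) * (cos (2 * pi * (alpha j : R) * n%:R + 0) * w n)
    + complex.Im (c j) * (cos (2 * pi * (alpha j : R) * n%:R + pi / 2) * w n))).
  by apply: cvg_mean_sum => j _; apply: cvg_mean_lin; exact: wl.
apply/funext => n; rewrite Re_trig_poly mulr_suml; apply: eq_bigr => j _.
by rewrite mulrDl !mulrA.
Qed.

Lemma norm_Re_le (z : R[i]) : `|complex.Re z| <= ComplexField.Normc.normc z.
Proof.
case: z => a b /=; rewrite -sqrtr_sqr ler_wsqrtr// lerDl; exact: sqr_ge0.
Qed.

Lemma window_sum (F : nat -> R) M N :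
  \sum_(M.+1 <= n < (M + N).+1) F n = \sum_(i < N) F (M + i).+1.
Proof.
rewrite -[M.+1 in LHS]add0n big_addn subSS addKn big_mkord.
by apply: eq_bigr => i _; rewrite addnS addnC.
Qed.

Lemma window_freqE A M N :
  window_freq R A M N = mean (fun n => (n \in A)%:R) (M, N).
Proof.
rewrite /window_freq /window_card /mean /= -sum1_count natr_sum.
rewrite -(window_sum (fun n => (n \in A)%:R)).
by rewrite big_mkcond; congr (_ / _); apply: eq_bigr => n _; case: ifP.
Qed.

(** Since an indicator is real, taking the real part of its approximant can
    only decrease the distance. *)
Lemma mean_dist_le A (g : nat -> R[i]) p :
  mean (fun n => `|(n \in A)%:R - complex.Re (g n)|) p
  <= window_dist (\1_A) g p.1 p.2.
Proof.
rewrite /mean /window_dist -(window_sum (fun n => `|(n \in A)%:R - _|)).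
rewrite ler_wpM2r ?invr_ge0//; apply: ler_sum => n _.
apply: le_trans (norm_Re_le _); rewrite indicE.
by case: (g n) => a b; case: (n \in A).
Qed.

End TrigonometricPolynomials.

(** * Windows along an increasing sequence *)

Section Subsequence.
Variable R : realType.
Implicit Types (p : nat * nat).

(** The value at index 0 is reset to 0 so that the window of indices
    {1, ..., K} corresponds to the window {1, ..., n_K} of integers, which starts
    at an admissible origin also for S = {0}. *)
Definition subindex (n_ : nat -> nat) (k : nat) : nat :=
  if k is 0%N then 0%N else n_ k.

Definition subwindow (n_ : nat -> nat) p : nat * nat :=
  (subindex n_ p.1, subindex n_ (p.1 + p.2) - subindex n_ p.1)%N.

Lemma subindex_mono (n_ : nat -> nat) : increasing_sequence n_ ->
  {homo subindex n_ : j k / (j < k)%N}.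
Proof.
case=> n0 nlt.
by move=> [|j] [|k] //= jk; [exact: n0|exact: nlt].
Qed.

Lemma subindex_gap (n_ : nat -> nat) M K : increasing_sequence n_ ->
  (subindex n_ M + K <= subindex n_ (M + K))%N.
Proof.
move=> n_inc; elim: K => [|K IH]; first by rewrite !addn0.
by rewrite !addnS (leq_ltn_trans IH)// subindex_mono.
Qed.

Lemma sum_subsequence (n_ : nat -> nat) (f : nat -> R) M K :
  increasing_sequence n_ ->
  \sum_(i < K) f (n_ (M + i).+1) =
  \sum_((subindex n_ M).+1 <= n < (subindex n_ (M + K)).+1)
     (n \in sequence_range n_)%:R * f n.
Proof.
move=> n_inc; have lt_sub := subindex_mono n_inc.
have le_sub j k : (j <= k)%N -> (subindex n_ j <= subindex n_ k)%N.
  by rewrite leq_eqVlt => /predU1P[->//|/lt_sub/ltnW].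
elim: K => [|K IH]; first by rewrite big_ord0 addn0 big_geq.
rewrite big_ord_recr IH addnS /=.
rewrite [RHS](@big_cat_nat _ _ _ (subindex n_ (M + K)).+1)//=; last 2 first.
- by rewrite ltnS le_sub// leq_addr.
- by rewrite ltnS (le_sub _ (M + K).+1).
congr (_ + _); rewrite big_nat_recr/=; last by rewrite (lt_sub _ (M + K).+1).
rewrite big_nat_cond big1 => [|n /andP[/andP[Mn nM] _]].
  by rewrite add0r mem_set ?mul1r//; exists (M + K).+1.
rewrite memNset ?mul0r// => -[j /= j0 jn].
have E : subindex n_ j = n by case: j j0 jn.
have [jK|Kj] := leqP j (M + K).
  by have := le_sub _ _ jK; rewrite E leqNgt Mn.
by have := le_sub _ _ Kj; rewrite E /= leqNgt nM.
Qed.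

Lemma mean_subsequence (n_ : nat -> nat) (f : nat -> R) p :
  increasing_sequence n_ -> (0 < p.2)%N ->
  mean (fun k => f (n_ k)) p =
  mean (fun n => (n \in sequence_range n_)%:R * f n) (subwindow n_ p)
  / mean (fun n => (n \in sequence_range n_)%:R) (subwindow n_ p).
Proof.
move=> n_inc; case: p => M K /= K0; set w := subwindow _ _.
have sub (g : nat -> R) : \sum_(i < K) g (n_ (M + i).+1) =
    mean (fun n => (n \in sequence_range n_)%:R * g n) w * w.2%:R.
  have gap := subindex_gap M K n_inc.
  rewrite (sum_subsequence g M K n_inc) /mean divfK; last first.
    by rewrite pnatr_eq0 /=; lia.
  rewrite -(window_sum (fun n => (n \in sequence_range n_)%:R * g n)) /=.
  by rewrite subnKC//; lia.
have K0' : K%:R != 0 :> R by rewrite pnatr_eq0 -lt0n.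
have := sub (fun=> 1); rewrite sumr_const card_ord => KE.
have mulE g : mean (fun n => g n * 1) w = mean g w :> R.
  by apply: eq_mean => n; rewrite mulr1.
move: KE; rewrite mulE => KE; rewrite {1}/mean /= sub KE.
move: K0'; rewrite KE mulf_eq0 negb_or => /andP[a0 b0].
by field; rewrite a0 b0.
Qed.

Lemma near_subwindow (n_ : nat -> nat) S (P : nat * nat -> Prop) :
  increasing_sequence n_ ->
  (forall M, S M -> S (subindex n_ M)) ->
  (\forall p \near windows S, P p) ->
  \forall p \near windows S, P (subwindow n_ p).
Proof.
move=> n_inc SS [N0 _ hN]; exists N0 => // K K0 M SM.
apply: (hN _ _ _ (SS _ SM)) => /=.
by have := subindex_gap M K n_inc; move: K0 => /=; lia.
Qed.

End Subsequence.

(** * Sets whose indicator is approximable by trigonometric polynomials *)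

Section Approximable.
Variable R : realType.
Implicit Types (S A : set nat) (omega phi : R) (u : nat -> torus R).

(** Besicovitch almost periodicity of the indicator of A, with the limsup
    spelled out and the choice of windows left open. *)
Definition trig_approximable S A : Prop := forall e : R, 0 < e ->
  exists (k : nat) (alpha : 'I_k -> torus R) (c : 'I_k -> R[i]),
    \forall p \near windows S,
      window_dist (\1_A) (trig_poly alpha c) p.1 p.2 < e.

(** As w is bounded, replacing the indicator by a trigonometric polynomial
    changes the mean of the product by at most their distance in mean. *)
Lemma cvg_mean_approximable S A (w : nat -> R) :
  trig_approximable S A -> (forall n, `|w n| <= 1) ->
  (forall omega phi,
     mean (fun n => cos (omega * n%:R + phi) * w n) @ windows S --> 0) ->
  mean (fun n => (n \in A)%:R * w n) @ windows S --> 0.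
Proof.
move=> SA w1 wl; apply/cvgrPdist_lt => e e0.
have e2 : 0 < e / 2 by rewrite divr_gt0.
have [k [alpha [c close]]] := SA _ e2.
have [L [LE]] := cvg_mean_trig_poly alpha c wl.
have {LE} -> : L = 0 by rewrite LE big1// => j _; rewrite !mulr0 addr0.
move=> /cvgrPdist_lt/(_ _ e2) trig0.
near=> p; rewrite sub0r normrN.
pose g n := complex.Re (trig_poly alpha c n).
have -> : mean (fun n => (n \in A)%:R * w n) p =
    mean (fun n => ((n \in A)%:R - g n) * w n) p + mean (fun n => g n * w n) p.
  by rewrite -meanD; apply: eq_mean => n; rewrite mulrBl subrK.
apply: le_lt_trans (ler_normD _ _) _; rewrite [ltRHS](splitr e); apply: ltrD.
  apply: le_lt_trans (norm_mean_le _ _) _.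
  apply: (@le_lt_trans _ _ (window_dist (\1_A) (trig_poly alpha c) p.1 p.2)).
    apply: le_trans (mean_dist_le _ _ _); apply: le_mean => n.
    by rewrite normrM ler_piMr.
  by near: p.
by rewrite -normrN -sub0r; near: p.
Unshelve. all: by end_near. Qed.

(** Trigonometric polynomials have means, and the indicator is within e / 2 of
    one of them. *)
Lemma mean_ind_nearly_constant S A (e : R) : trig_approximable S A -> 0 < e ->
  exists L : R, \forall p \near windows S, `|L - mean (fun n => (n \in A)%:R) p| < e.
Proof.
move=> SA e0; have e2 : 0 < e / 2 by rewrite divr_gt0.
have [k [alpha [c close]]] := SA _ e2.
pose l omega phi := get [set l : R |
  mean (fun n => cos (omega * n%:R + phi) * 1) @ windows S --> l].
have ll omega phi :
    mean (fun n => cos (omega * n%:R + phi) * 1) @ windows S --> l omega phi.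
  have [y yl] := cvg_mean_cos S omega phi.
  apply: (@getPex _ [set l : R |
    mean (fun n => cos (omega * n%:R + phi) * 1) @ windows S --> l]).
  by exists y => /=; under [fun n => _]eq_fun do rewrite mulr1.
have [L [_ /cvgrPdist_lt/(_ _ e2) gL]] := cvg_mean_trig_poly alpha c ll.
exists L; near=> p; pose g n := complex.Re (trig_poly alpha c n).
rewrite -(subrKA (mean (fun n => g n * 1) p)).
apply: le_lt_trans (ler_normD _ _) _; rewrite [ltRHS](splitr e); apply: ltrD.
  by near: p.
rewrite -meanB; apply: le_lt_trans (norm_mean_le _ _) _.
apply: (@le_lt_trans _ _ (window_dist (\1_A) (trig_poly alpha c) p.1 p.2)).
  apply: le_trans (mean_dist_le _ _ _); apply: le_mean => n.
  by rewrite mulr1 distrC.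
by near: p.
Unshelve. all: by end_near. Qed.

Lemma limn_esup_lt_near (v : nat -> \bar R) (y : \bar R) :
  (limn_esup v < y)%E -> \forall n \near \oo, (v n < y)%E.
Proof.
rewrite /limn_esup limf_esupE => /ereal_inf_lt[_ [V /= VF <-] supV].
apply: filterS VF => n Vn; apply: le_lt_trans supV; apply: ereal_sup_ubound.
by exists n.
Qed.

Lemma lt_limn_esup_ex (v : nat -> \bar R) (y : \bar R) (P : set nat) :
  (y < limn_esup v)%E -> (\forall n \near \oo, P n) ->
  exists2 n, P n & (y < v n)%E.
Proof.
rewrite /limn_esup limf_esupE => yv PF.
have : (y < ereal_sup [set v n | n in P])%E.
  by apply: lt_le_trans yv _; apply: ereal_inf_lbound; exists P.
by move=> /ereal_sup_gt[_ [n Pn <-] yn]; exists n.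
Qed.

(** The averages stay within r / 4 of a constant L, and one of them exceeds
    r by positivity of the limsup; hence L > 3 r / 4 and all later averages
    exceed r / 2. *)
Lemma upper_density_gt0 A : trig_approximable [set 0%N] A ->
  (0 < upper_density R A)%E ->
  exists2 c : R, 0 < c &
    \forall p \near windows [set 0%N], c <= mean (fun n => (n \in A)%:R) p.
Proof.
move=> SA dA.
have [r r0 rA] : exists2 r : R, 0 < r & (r%:E < upper_density R A)%E.
  move: dA; case: (upper_density R A) => [d| |//].
    rewrite lte_fin => d0; exists (d / 2); first by rewrite divr_gt0.
    by rewrite lte_fin ltr_pdivrMr// ltr_pMr// ltr1n.
  by exists 1; rewrite ?ltry.
have r4 : 0 < r / 4 by rewrite divr_gt0.
have [L LA] := mean_ind_nearly_constant SA r4.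
have LA0 := LA; rewrite near_windowsE in LA0.
have [N /(_ 0%N erefl)] := lt_limn_esup_ex rA LA0.
rewrite lte_fin window_freqE ltr_norml => /andP[h1 h2] h3.
exists (r / 4) => //; apply: filterS LA => p.
rewrite ltr_norml => /andP[? ?]; lra.
Qed.

(** The infimum defining the density runs over the origins M >= 1 only; shift
    invariance recovers the origin 0 at the cost of a factor 2. *)
Lemma lower_banach_density_gt0 A : (0 < lower_banach_density R A)%E ->
  exists2 c : R, 0 < c &
    \forall p \near windows setT, c <= mean (fun n => (n \in A)%:R) p.
Proof.
rewrite /lower_banach_density; set v := fun N : nat => ereal_inf _ => v0.
have [r r0 vr] : exists2 r : R, 0 < r & \forall N \near \oo, (r%:E < v N)%E.
  (* Without convergence the limit would take the default value 0. *)
  have : v @ \oo --> limn v.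
    by apply: contrapT => nv; move: v0; rewrite (dvgP nv) ltxx.
  move: v0; case: (limn v) => [d d0 vd|_ vy|//].
    exists (d / 2); first by rewrite divr_gt0.
    apply: (vd [set y | ((d / 2)%:E < y)%E]).
    apply: (nbhs_open_ereal_gt (f := fun y => y / 2)).
    by rewrite ltr_pdivrMr// ltr_pMr// ltr1n.
  exists 1 => //; apply: (vy [set y | (1%:E < y)%E]).
  exact: nbhs_open_ereal_pinfty.
exists (r / 2); first by rewrite divr_gt0.
have banach M N : (r%:E < v N)%E -> (0 < M)%N ->
    r < mean (fun n => (n \in A)%:R) (M, N).
  move=> rN M0; rewrite -lte_fin; apply: lt_le_trans rN _.
  by rewrite -window_freqE; apply: ereal_inf_lbound; exists M.
have r2 : 0 < r / 2 by rewrite divr_gt0.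
have ind_le1 n : `|(n \in A)%:R| <= 1 :> R.
  by case: (n \in A); rewrite ?normr1 ?normr0.
move/cvgrPdist_lt : (@cvg_mean_shiftB R setT _ 1 1 ind_le1) => /(_ _ r2) shift.
near=> p; have rN : (r%:E < v p.2)%E.
  near: p; rewrite near_windowsE.
  by apply: filterS vr => N vN M _.
have := banach (p.1.+1) _ rN isT.
have : `|0 - mean (fun n => ((n + 1)%N \in A)%:R - (n \in A)%:R) p| < r / 2.
  by near: p.
rewrite meanB.
rewrite (_ : mean (fun n => ((n + 1)%N \in A)%:R) p =
  mean (fun n => (n \in A)%:R) (p.1.+1, p.2)).
  by rewrite ltr_norml => /andP[? ?] ?; lra.
by rewrite /mean; congr (_ / _); apply: eq_bigr => i _ /=; rewrite addn1.
Unshelve. all: by end_near. Qed.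

End Approximable.

(** * Equidistribution along the sequence *)

Section AlongSequence.
Variable R : realType.
Implicit Types (S A : set nat) (omega phi : R) (u x : nat -> torus R).

(** Subtraction in R/Z and in R differ by an integer, a period of the wave. *)
Lemma wave_torusB m phi (s t : torus R) :
  wave m phi (s - t : torus R) = wave m phi ((s : R) - (t : R)).
Proof.
have [z ->] : exists z : int, ((s - t : torus R) : R) = (s : R) - (t : R) + z%:~R.
  exists (- Num.floor ((s : R) - (t : R))); rewrite mulrNz -/(fracr _).
  by rewrite /= /torus_opp /= fracrDr.
rewrite /wave (_ : _ + phi =
  2 * pi * (m%:R * ((s : R) - (t : R))) + phi + 2 * pi * (m%:Z * z)%:~R).
  exact: cosDz2pi.
by rewrite intrM; ring.
Qed.

(** The linear phase omega n adds the constant omega h to the h-th difference,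
    so that van der Corput's theorem applies to every frequency at once; the
    product of two cosines is a combination of two such twisted waves. *)
Lemma cvg_mean_twisted_wave S u m psi omega phi :
  (forall h, (0 < h)%N -> equidistributed S (fun n => u (n + h)%N - u n)) ->
  (0 < m)%N ->
  mean (fun n => cos (omega * n%:R + phi) * wave m psi (u n)) @ windows S --> 0.
Proof.
move=> du m0.
have vdc (om ph : R) :
  mean (fun n => cos (2 * pi * (m%:R * (u n : R)) + (om * n%:R + ph)))
    @ windows S --> 0.
  apply: van_der_corput => h h0.
  rewrite (_ : (fun _ => _) =
    fun n => wave m (om * h%:R) (u (n + h)%N - u n : torus R)).
    exact: equidistributed_wave (du _ h0) _ _ m0.
  by apply/funext => n; rewrite wave_torusB natrD; congr cos; ring.
rewrite (_ : (fun _ => _) = fun n =>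
    2^-1 * cos (2 * pi * (m%:R * (u n : R)) + (omega * n%:R + (phi + psi)))
  + 2^-1 * cos (2 * pi * (m%:R * (u n : R)) + (- omega * n%:R + (psi - phi)))).
  rewrite [X in _ --> X](_ : _ = 2^-1 * 0 + 2^-1 * 0); last by ring.
  by apply: cvg_mean_lin; exact: vdc.
apply/funext => n; rewrite /wave cosM_sum mulrC mulrDr -[in X in _ + X]cosN.
by congr (_ * cos _ + _ * cos _); ring.
Qed.

(** The common form of both halves of the theorem: the mean along the sequence
    is a quotient whose numerator tends to 0 and whose denominator is at least c. *)
Theorem equidistributed_subsequence S u (n_ : nat -> nat) (c : R) :
  (forall h, (0 < h)%N -> equidistributed S (fun n => u (n + h)%N - u n)) ->
  increasing_sequence n_ -> (forall M, S M -> S (subindex n_ M)) ->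
  trig_approximable R S (sequence_range n_) -> 0 < c ->
  (\forall p \near windows S, c <= mean (fun n => (n \in sequence_range n_)%:R) p) ->
  equidistributed S (fun k => u (n_ k)).
Proof.
move=> du inc SS appr c0 dens; apply: weyl_criterion => m phi m0.
have tw : mean (fun n => (n \in sequence_range n_)%:R * wave m phi (u n))
    @ windows S --> 0.
  apply: cvg_mean_approximable appr _ _ => [n|omega psi]; first exact: cos_max.
  exact: cvg_mean_twisted_wave.
apply/cvgrPdist_lt => e e0; have ec : 0 < e * c by rewrite mulr_gt0.
move/cvgrPdist_lt : tw => /(_ _ ec) tw.
have {}tw := near_subwindow inc SS tw.
have {}dens := near_subwindow inc SS dens.
near=> p; have p0 : (0 < p.2)%N by near: p; exact: windows_ge.
rewrite (mean_subsequence (fun n => wave m phi (u n)) inc p0).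
have cp : c <= mean (fun n => (n \in sequence_range n_)%:R) (subwindow n_ p).
  by near: p.
have dp := lt_le_trans c0 cp.
rewrite sub0r normrN normrM normfV (gtr0_norm dp) ltr_pdivrMr//.
apply: (@lt_le_trans _ _ (e * c)); last by rewrite ler_pM2l.
rewrite -normrN -sub0r; near: p; exact: tw.
Unshelve. all: by end_near. Qed.

Lemma mean_ico_ind x (a b : R) p :
  window_freq R [set n | a <= (x n : R) < b] p.1 p.2
  = mean (fun n => ico_ind a b (x n)) p.
Proof.
rewrite window_freqE; case: p => M N; apply: eq_mean => n; rewrite /ico_ind.
case: (boolP (_ <= _ < _)) => h; first by rewrite mem_set.
by rewrite memNset//; exact/negP.
Qed.

Lemma uniformly_distributedE x :
  uniformly_distributed x <-> equidistributed [set 0%N] x.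
Proof.
split=> xu a b a0 ab b1.
- apply/cvgrPdist_lt => e e0.
  have /cvgrPdist_lt/(_ e e0) := xu a b a0 ab b1.
  by apply: filterS => N hN _ ->; rewrite -mean_ico_ind.
- apply/cvgrPdist_lt => e e0.
  have /cvgrPdist_lt/(_ e e0) := xu a b a0 ab b1.
  rewrite near_windowsE; apply: filterS => N /(_ 0%N erefl).
  by rewrite -mean_ico_ind.
Qed.

Lemma well_distributedE x :
  well_distributed x <-> equidistributed setT x.
Proof.
split=> xu a b a0 ab b1.
- apply/cvgrPdist_lt => e e0.
  have := xu a b a0 ab b1 e e0.
  by apply: filterS => N hN M _; rewrite -mean_ico_ind distrC.
- move=> e e0; have /cvgrPdist_lt/(_ e e0) := xu a b a0 ab b1.
  rewrite near_windowsE; apply: filterS => N hN M; rewrite distrC.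
  by have := hN M I; rewrite -mean_ico_ind.
Qed.

Lemma besicovitch_approximable A :
  besicovitch_ap (\1_A : nat -> R[i]) -> trig_approximable R [set 0%N] A.
Proof.
move=> bA e /bA[k [alpha [c [_ /limn_esup_lt_near close]]]].
exists k, alpha, c; apply: filterS close => N; rewrite lte_fin => eN _ ->.
exact: eN.
Qed.

Lemma uniform_besicovitch_approximable A :
  uniform_besicovitch_ap (\1_A : nat -> R[i]) -> trig_approximable R setT A.
Proof.
move=> bA e /bA[k [alpha [c [_ /limn_esup_lt_near close]]]].
exists k, alpha, c; apply: filterS close => N eN M _.
rewrite -lte_fin; apply: le_lt_trans eN; apply: ereal_sup_ubound.
by exists M.
Qed.

End AlongSequence.

Theorem theorem4p4 (R : realType) (u : nat -> torus R) :
  ((forall h : nat, (0 < h)%N ->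
      uniformly_distributed (fun n => u (n + h)%N - u n)) ->
   forall n_ : nat -> nat, besicovitch_sequence R n_ ->
     uniformly_distributed (fun k => u (n_ k)))
  /\
  ((forall h : nat, (0 < h)%N ->
      well_distributed (fun n => u (n + h)%N - u n)) ->
   forall n_ : nat -> nat, uniform_besicovitch_sequence R n_ ->
     well_distributed (fun k => u (n_ k))).
Proof.
split=> du n_ [inc ap dA].
- have appr := besicovitch_approximable ap.
  have [c c0 dens] := upper_density_gt0 appr dA.
  apply/uniformly_distributedE; apply: equidistributed_subsequence c0 dens => //.
    by move=> h /du/uniformly_distributedE.
  by move=> _ ->.
- have appr := uniform_besicovitch_approximable ap.
  have [c c0 dens] := lower_banach_density_gt0 dA.
  apply/well_distributedE; apply: equidistributed_subsequence c0 dens => //.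
  by move=> h /du/well_distributedE.
Qed.
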